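(* Let $y$ be a single observed value of a random variable $Y$ having the maximum negative hypergeometric distribution with parameters $(N,m,c)$, where $N$ and $c$ are known and $m$ is unknown and treated as continuous valued. Let $$\Lambda(m)=\log\left\{\frac{m^{(c)}(N-m)^{(c+y)}+m^{(c+y)}(N-m)^{(c)}}{N^{(2c+y)}}\right\}$$ be the log-likelihood kernel of $m$. Then: (a) $\Lambda$ always has a critical value at $m=N/2$: $\Lambda'(N/2)=0$. This critical point may be either a global maximum or a local minimum, depending on the sign of $\Lambda''$ there: $\Lambda$ has either one mode, at $\widehat m=N/2$, or else two modes, symmetric about $N/2$, depending on the sign of $\Lambda''(N/2)$. If $\Lambda''(N/2)$ is negative, there is one mode of $\Lambda$, at $N/2$. (b) The sign of $\Lambda''(N/2)$ is the same as that of $$\phi(N,c,y)=\sum_{0\le k<k'\le y-1}\frac{1}{(N/2-c-k)(N/2-c-k')}\;-\;\sum_{i=0}^{c-1}\frac{1}{(N/2-i)^2}.$$ (c) The first sum in $\phi$ is zero when $y=0$ or $y=1$. The function $\phi$ is then negative for small values of $y$, and in these cases the maximum likelihood estimate of $m$ is $\widehat m=N/2$. Moreover $\phi$ is an increasing function of $y$ and may eventually become positive for larger values of $y$, so that $\Lambda$ will have two modes. These modes are symmetric about $N/2$ because $\Lambda(m)=\Lambda(N-m)$ for all $0<m<N$.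
   Context: For a real number $z$ and integer $k\ge1$, $z^{(k)}=z(z-1)\cdots(z-k+1)$ is the falling factorial, and $z^{(0)}=1$. Primes denote derivatives with respect to $m$, and empty sums are zero. Maximum negative hypergeometric distribution with integer parameters $(N,m,c)$, where $1\le c\le m<N$ and $c\le N-m$: an urn contains $N$ balls, $m$ of one color and $N-m$ of another; balls are drawn without replacement until at least $c$ balls of both colors have been observed; $Y$ is the number of draws needed minus $2c$. Its probability mass function is $$\Pr[Y=y]=\binom{2c+y-1}{c-1}\,\frac{m^{(c+y)}(N-m)^{(c)}+m^{(c)}(N-m)^{(c+y)}}{N^{(2c+y)}},\qquad 0\le y\le\max\{m-c,\,N-m-c\}.$$
   Formalization: The claims on modes, the MLE and φ increasing are stated for c+y-1 < N/2 (false or undefined otherwise, e.g. N=7, c=1, y=5), with m in [c, N-c] or (c-1, N-c+1); Λ'(N/2)=0 and the sign of Λ''(N/2) are stated when the likelihood at N/2 is positive. *)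

(* Defs.v *)
From HB Require Import structures.
From mathcomp Require Import all_boot all_order all_algebra.
From mathcomp Require Import all_classical all_reals all_analysis.
Set Implicit Arguments.
Unset Strict Implicit.
Unset Printing Implicit Defensive.
Import Order.TTheory GRing.Theory Num.Theory.
Import numFieldNormedType.Exports.
Local Open Scope classical_set_scope.
Local Open Scope ring_scope.

Definition falling (R : realType) (z : R) (k : nat) : R :=
  \prod_(i < k) (z - i%:R).

(* The probability mass function; [m] is real so that the same expression,
   read as a function of [m], is the likelihood. *)
Definition mnh_pmf (R : realType) (N : nat) (m : R) (c y : nat) : R :=
  'C((2 * c + y).-1, c.-1)%:R *
  ((falling m (c + y) * falling (N%:R - m) c +
    falling m c * falling (N%:R - m) (c + y)) / falling N%:R (2 * c + y)).

Definition max_neg_hypergeometric (d : measure_display) (T : measurableType d)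
    (R : realType) (P : probability T R) (Y : {RV P >-> nat}) (N m c : nat) :=
  [/\ (1 <= c)%N, (c <= m)%N, (m < N)%N, (c <= N - m)%N &
      forall k : nat, P (Y @^-1` [set k]) =
        (if (k <= maxn (m - c) (N - m - c))%N then mnh_pmf N m%:R c k
         else 0)%:E].

Definition lik_kernel (R : realType) (N c y : nat) (m : R) : R :=
  (falling m c * falling (N%:R - m) (c + y) +
   falling m (c + y) * falling (N%:R - m) c) / falling N%:R (2 * c + y).

(* [ln] is total, with value 0 at nonpositive reals, so [Lambda] is only
   meaningful where [lik_kernel] is positive. *)
Definition Lambda (R : realType) (N c y : nat) (m : R) : R :=
  ln (lik_kernel N c y m).

Definition phi_pairs (R : realType) (N c y : nat) : R :=
  \sum_(k < y) \sum_(k' < y | (k < k')%N)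
    ((N%:R / 2 - c%:R - k%:R) * (N%:R / 2 - c%:R - k'%:R))^-1.

Definition phi (R : realType) (N c y : nat) : R :=
  phi_pairs R N c y - \sum_(i < c) ((N%:R / 2 - i%:R) ^+ 2)^-1.

(* All the factors N/2 - k, k < c + y, of the falling factorials at m = N/2 are
   positive, i.e. c + y - 1 < N/2. Beyond this range the terms of [phi] can be
   undefined or change sign, and the likelihood can vanish at N/2. *)
Definition central_range (N c y : nat) : bool := ((c + y).*2 <= N.+1)%N.

(* The constraints c <= m and c <= N - m, for a continuous parameter m. *)
Definition param_range (R : realType) (N c : nat) : set R :=
  [set m | c%:R <= m <= N%:R - c%:R].

(* The largest interval around N/2 on which [falling m c] and
   [falling (N - m) c] are both positive. *)
Definition kernel_range (R : realType) (N c : nat) : set R :=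
  [set m | c%:R - 1 < m < N%:R - c%:R + 1].

Definition global_maxima (R : realType) (D : set R) (f : R -> R) : set R :=
  [set x | D x /\ forall x', D x' -> f x' <= f x].

Definition local_maxima (R : realType) (D : set R) (f : R -> R) : set R :=
  [set x | D x /\ \forall x' \near x, D x' -> f x' <= f x].

Definition local_minima (R : realType) (D : set R) (f : R -> R) : set R :=
  [set x | D x /\ \forall x' \near x, D x' -> f x <= f x'].

(* [S] is the set of modes of [f] on [D], in either sense of the word. *)
Definition modes_are (R : realType) (D : set R) (f : R -> R) (S : set R) :=
  local_maxima D f = S /\ global_maxima D f = S.

Definition one_central_mode (R : realType) (D : set R) (N : nat) (f : R -> R) :=
  modes_are D f [set N%:R / 2].

Definition two_symmetric_modes (R : realType) (D : set R) (N : nat)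
    (f : R -> R) :=
  exists2 x : R, 0 < x &
    modes_are D f [set (N%:R / 2 - x); (N%:R / 2 + x)].

Definition MLE (R : realType) (D : set R) (N c y : nat) : set R :=
  global_maxima D (fun m => mnh_pmf N m c y).

(* Main.v *)
Require Import Defs.
From HB Require Import structures.
From mathcomp Require Import all_boot all_order all_algebra.
From mathcomp Require Import all_classical all_reals all_analysis.
From mathcomp Require Import zify ring lra.
Set Implicit Arguments.
Unset Strict Implicit.
Unset Printing Implicit Defensive.
Import Order.TTheory GRing.Theory Num.Theory.
Import numFieldNormedType.Exports.
Local Open Scope classical_set_scope.
Local Open Scope ring_scope.

(** Put m = N/2 + x, t = x^2 and a_k = N/2 - c - k. Pairing the common factors of
    m^(c) (N-m)^(c), the likelihood kernel becomes, up to a positive constant,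
    a polynomial in t alone,
      G(t) = prod_(i<c) ((N/2 - i)^2 - t) * E(t),
    where E(x^2) is the even part of P(x) = prod_(k<y) (a_k + x)
    ([lik_kernelE]). This gives the symmetry about N/2 and the critical point
    there. It also gives Lambda''(N/2) = 2 G'(0)/G(0), and the logarithmic
    derivative G'(0)/G(0) is exactly phi: the second elementary symmetric
    function of the 1/a_k comes from E, the squares from the other factors
    ([kernel_poly_center], [Lambda_center]).

    The number of modes follows from strict log-concavity of G in t, which holds
    where all the factors N/2 - i - |x|, i < c, are positive. The factors
    (N/2 - i)^2 - t are strictly log-concave. That E is log-concave on t >= 0 would
    follow from Hermite-Biehler (P has negative roots, so E has only negative
    roots). Here it is proved without roots, by an induction on y in which the
    signs of several quantities attached to the even and odd parts of P propagate
    together ([even_part_logconc]).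

    Since G'/G decreases strictly, G increases up to some tm and decreases
    afterwards, and tm = 0 exactly when G'(0) <= 0, unless the range is reduced
    to t = 0 ([logconc_peak]). In terms of m, the modes are N/2 - sqrt tm and
    N/2 + sqrt tm ([modes_of_peak], [range_modes]): one central mode when tm = 0,
    otherwise two symmetric ones with a local minimum at N/2. *)

(** * Log-concavity of the even part of a product of linear factors *)

(** The polarization of twice p'^2 - p p''; its value at (p, p) has the sign of
    - (log p)'' where p is positive. *)
Definition logconc_form (R : comNzRingType) (p q : {poly R}) : {poly R} :=
  (p^`() * q^`()) *+ 2 - p * q^`()^`() - p^`()^`() * q.

Definition wronskian (R : comNzRingType) (p q : {poly R}) : {poly R} :=
  p^`() * q - p * q^`().

Lemma logconc_formM (R : comNzRingType) (p q : {poly R}) (t : R) :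
  (logconc_form (p * q) (p * q)).[t] =
  p.[t] ^+ 2 * (logconc_form q q).[t] + q.[t] ^+ 2 * (logconc_form p p).[t].
Proof. by rewrite /logconc_form !poly.derivE !hornerE /=; ring. Qed.

(** The polynomials E and O with E(x^2) + x O(x^2) = prod_(j < k) (a_j + x). *)
Fixpoint even_odd (R : comNzRingType) (a : nat -> R) (k : nat) :
    {poly R} * {poly R} :=
  if k is k'.+1 then
    let: (p, q) := even_odd a k' in
    ((a k')%:P * p + 'X * q, (a k')%:P * q + p)
  else (1, 0).

Lemma even_oddP (R : comNzRingType) (a : nat -> R) (k : nat) (x : R) :
  (even_odd a k).1.[x ^+ 2] + x * (even_odd a k).2.[x ^+ 2] =
  \prod_(j < k) (a j + x).
Proof.
elim: k => [|k IHk]; first by rewrite big_ord0 /= !hornerE.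
rewrite big_ord_recr /= -IHk; case: (even_odd a k) => p q /=.
by rewrite !hornerE; ring.
Qed.

(** Besides E > 0 and O >= 0, the induction carries the three values of
    [logconc_form] on the pair (E, O) and two quantities recording how O/E varies:
    the Wronskian W = E' O - E O' = - E^2 (O/E)', and
    V = E O - t W = E^2 (t O/E)'. Nonnegativity of both means that O/E decreases
    while t O/E increases. Appending a factor a + x replaces (E, O) by
    (a E + t O, a O + E), and each of these quantities becomes a combination of the
    old ones with nonnegative coefficients. *)
Lemma even_part_logconc (R : realFieldType) (a : nat -> R) (k : nat) (t : R) :
  0 <= t -> (forall j, (j < k)%N -> 0 < a j) ->
  0 < (even_odd a k).1.[t] /\
  0 <= (logconc_form (even_odd a k).1 (even_odd a k).1).[t].
Proof.
move=> t0 a0.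
suff : let: (p, q) := even_odd a k in
    [/\ 0 < p.[t], 0 <= q.[t], 0 <= (wronskian p q).[t] &
        0 <= (p * q - 'X * wronskian p q).[t]] /\
    [/\ 0 <= (logconc_form p p).[t], 0 <= (logconc_form p q).[t] &
        0 <= (logconc_form q q).[t]].
  by case: (even_odd a k) => p q [[? _ _ _] [? _ _]].
elim: k a0 => [|k IHk] a0 /=.
  rewrite /logconc_form /wronskian !poly.derivE !hornerE.
  by rewrite !(oppr0, mulr0, subr0) ltr01 lexx.
have ak0 : 0 <= a k by apply/ltW/a0.
have := IHk (fun j jk => a0 j (ltnW jk)).
case: (even_odd a k) => p q /= [[p0 q0 w0 v0] [pp0 pq0 qq0]].
set b := a k in ak0 *; set p' := _ + 'X * q; set q' := _ + p.
(* The minus sign in the direct expansion (a^2 - t) W + a O^2 + O E is absorbed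
   by V. *)
have w'E : wronskian p' q' = (b ^+ 2)%:P * wronskian p q + b%:P * q ^+ 2 +
    (p * q - 'X * wronskian p q).
  by rewrite /wronskian /p' /q' !poly.derivE polyCM; ring.
have v'E : p' * q' - 'X * wronskian p' q' =
    (b ^+ 2)%:P * (p * q - 'X * wronskian p q) + b%:P * p ^+ 2 +
    'X ^+ 2 * wronskian p q.
  by rewrite /wronskian /p' /q' !poly.derivE polyCM; ring.
have pp'E : logconc_form p' p' = (b ^+ 2)%:P * logconc_form p p +
    b%:P * (wronskian p q *+ 2 + 'X * logconc_form p q) *+ 2 +
    (q ^+ 2 *+ 2 + 'X ^+ 2 * logconc_form q q).
  by rewrite /logconc_form /wronskian /p' !poly.derivE polyCM; ring.
have pq'E : logconc_form p' q' = (b ^+ 2)%:P * logconc_form p q +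
    b%:P * logconc_form p p + b%:P * ('X * logconc_form q q) +
    (wronskian p q *+ 2 + 'X * logconc_form p q).
  by rewrite /logconc_form /wronskian /p' /q' !poly.derivE polyCM; ring.
have qq'E : logconc_form q' q' = (b ^+ 2)%:P * logconc_form q q +
    b%:P * logconc_form p q *+ 2 + logconc_form p p.
  by rewrite /logconc_form /q' !poly.derivE polyCM; ring.
rewrite v'E w'E pp'E pq'E qq'E /p' /q' {p' q' w'E v'E pp'E pq'E qq'E}.
move: (p * q - 'X * wronskian p q) v0 => v v0.
move: (wronskian p q) w0 => w w0.
move: (logconc_form p p) pp0 => pp pp0.
move: (logconc_form p q) pq0 => pq pq0.
move: (logconc_form q q) qq0 => qq qq0.
rewrite !(hornerD, hornerM, hornerC, hornerX, hornerMn, horner_exp).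
do 2! split; rewrite ?(addr_ge0, mulr_ge0, mulrn_wge0, sqr_ge0, exprn_ge0, ltW p0) //.
by rewrite ltr_wpDr ?mulr_ge0 // mulr_gt0 // a0.
Qed.

(** * Unimodality of log-concave polynomials *)
Section Unimodal.
Variable R : realType.
Implicit Types (p : {poly R}) (J : set R).

Lemma poly_MVT p (a b : R) : a < b ->
  exists2 c, a < c < b & p.[b] - p.[a] = p^`().[c] * (b - a).
Proof.
move=> ab.
have [|c] := @MVT R (horner p) (horner p^`()) a b ab (fun x _ => is_derive_poly p x).
  by apply: continuous_subspaceT => x; apply: continuous_horner.
by rewrite in_itv /=; exists c.
Qed.

(** The logarithmic derivative of p decreases strictly. *)
Lemma logconc_deriv_lt0 p (a b : R) : a < b ->
  (forall t, a <= t <= b -> 0 < p.[t] /\ 0 < (logconc_form p p).[t]) ->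
  p^`().[a] <= 0 -> p^`().[b] < 0.
Proof.
move=> ab pP pa.
pose q (x : R) : R := p^`().[x] * (p.[x])^-1.
pose dq (x : R) : R := - ((logconc_form p p).[x] / 2) / p.[x] ^+ 2.
have qdq x : a <= x <= b -> is_derive x 1 q (dq x).
  move=> /pP[px _].
  have px0 : p.[x] != 0 by rewrite gt_eqF.
  have -> : dq x = p^`().[x] *: (- p.[x] ^- 2 *: p^`().[x]) +
                   (p.[x])^-1 *: p^`()^`().[x].
    rewrite /dq /logconc_form !hornerE /GRing.scale /=; field.
    by [].
  apply: is_deriveM; exact: is_deriveV.
have [|x|c] := @MVT R q dq a b ab.
- by move=> x; rewrite in_itv /= => /andP[? ?]; apply: qdq; rewrite !ltW.
- apply: continuous_in_subspaceT => y; rewrite inE /= in_itv /= => yab.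
  apply/differentiable_continuous/derivable1_diffP; apply: ex_derive; exact: qdq.
rewrite in_itv /= => /andP[ac cb] qE.
have [pc lc] : 0 < p.[c] /\ 0 < (logconc_form p p).[c] by apply: pP; rewrite !ltW.
have dqc : dq c < 0.
  by rewrite /dq mulNr oppr_lt0 divr_gt0 ?exprn_gt0 // divr_gt0.
have qa : q a <= 0.
  by rewrite /q mulr_le0_ge0 // invr_ge0 ltW //; have [] := pP a; rewrite ?lexx ?ltW.
have : dq c * (b - a) < 0 by rewrite nmulr_rlt0 ?subr_gt0.
rewrite -qE subr_lt0 => /lt_le_trans/(_ qa).
by rewrite /q pmulr_llt0 // invr_gt0; have [] := pP b; rewrite ?lexx ?ltW.
Qed.

(** A point where p' <= 0 forces p' < 0 at every later point of J, so p' changes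
    sign at most once; a maximum tm must be where it does. *)
Lemma logconc_peak p J (tm : R) :
  J 0 -> (forall s t, 0 <= s <= t -> J t -> J s) ->
  (forall t, J t -> 0 <= t) ->
  (forall t, J t -> 0 < p.[t] /\ 0 < (logconc_form p p).[t]) ->
  J tm -> (forall t, J t -> p.[t] <= p.[tm]) ->
  [/\ forall s t, 0 <= s < t -> t <= tm -> p.[s] < p.[t],
      forall s t, tm <= s < t -> J t -> p.[t] < p.[s],
      p^`().[0] <= 0 -> tm = 0 &
      0 < p^`().[0] -> (exists2 t, 0 < t & J t) -> 0 < tm].
Proof.
move=> J0 Jle Jge pP Jtm ptm; have tm0 := Jge _ Jtm.
have cross a b : 0 <= a < b -> J b -> p^`().[a] <= 0 -> p^`().[b] < 0.
  move=> /andP[a0 ab] Jb; apply: logconc_deriv_lt0 => // t /andP[at_ tb].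
  by apply/pP/(Jle _ b) => //; rewrite tb (le_trans a0).
split.
(* If p failed to increase from s to t, then p' <= 0 somewhere before tm, and p
   would decrease down to tm. *)
- move=> s t /andP[s0 st] ttm; rewrite ltNge; apply/negP => pts.
  have [c /andP[sc ct] cE] := poly_MVT p st.
  have pc : p^`().[c] <= 0.
    by rewrite -(@pmulr_lle0 _ (t - s)) ?subr_gt0 // -cE subr_le0.
  have ctm : c < tm by exact: lt_le_trans ttm.
  have c0 : 0 <= c by rewrite (le_trans s0) ?ltW.
  have [e /andP[ce etm] eE] := poly_MVT p ctm.
  have pe : p^`().[e] < 0.
    apply: (cross c) pc; first by rewrite c0 ce.
    by apply: (Jle _ tm) => //; rewrite (ltW etm) (le_trans c0 (ltW ce)).
  have : p.[c] <= p.[tm].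
    by apply/ptm/(Jle _ tm) => //; rewrite c0 ltW.
  by rewrite leNgt -subr_lt0 eE nmulr_rlt0 ?subr_gt0 ?ctm.
(* If p failed to decrease from s to t, then p' >= 0 somewhere after tm, although
   p' <= 0 between tm and that point. *)
- move=> s t /andP[tms st] Jt; rewrite ltNge; apply/negP => pst.
  have [c /andP[sc ct] cE] := poly_MVT p st.
  have pc : 0 <= p^`().[c].
    by rewrite -(@pmulr_lge0 _ (t - s)) ?subr_gt0 // -cE subr_ge0.
  have tmc : tm < c by exact: le_lt_trans sc.
  have Jc : J c by apply: (Jle _ t) => //; rewrite (ltW ct) (le_trans tm0 (ltW tmc)).
  have [e /andP[tme ec] eE] := poly_MVT p tmc.
  have pe : p^`().[e] <= 0.
    by rewrite -(@pmulr_lle0 _ (c - tm)) ?subr_gt0 // -eE subr_le0 ptm.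
  have := cross e c _ Jc pe; rewrite ec (le_trans tm0 (ltW tme)) => /(_ isT).
  by rewrite ltNge pc.
- move=> p0; apply/eqP; rewrite eq_le tm0 andbT leNgt; apply/negP => tm_gt0.
  have [c /andP[c0 ctm] cE] := poly_MVT p tm_gt0.
  have pc : p^`().[c] < 0.
    apply: (cross 0) p0; first by rewrite lexx.
    by apply: (Jle _ tm) => //; rewrite !ltW.
  have := ptm _ J0; rewrite leNgt -subr_lt0 cE nmulr_rlt0 ?subr0 //.
  by rewrite tm_gt0.
- move=> p0 [t t0 Jt]; rewrite lt_def tm0 andbT; apply/eqP => tmE.
  have : \forall x \near (0 : R), 0 < p^`().[x].
    by apply: (@cvgr_gt R R (nbhs (0:R)) _ (horner p^`()) _ (@continuous_horner R p^`() 0)).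
  move=> /nbhs_ballP[e /= e0 eP].
  pose u := Num.min t (e / 2).
  have u0 : 0 < u by rewrite /u lt_min t0 divr_gt0.
  have [c /andP[c0 cu] cE] := poly_MVT p u0.
  have ue : u < e.
    by apply: (@le_lt_trans _ _ (e / 2)); [rewrite /u ge_min lexx orbT | lra].
  have pc : 0 < p^`().[c].
    by apply: eP; rewrite /ball /= sub0r normrN gtr0_norm // (lt_trans cu).
  have : p.[u] <= p.[0].
    by rewrite -[X in _ <= p.[X]]tmE; apply/ptm/(Jle _ t) => //;
      rewrite (ltW u0) /u ge_min lexx.
  by rewrite leNgt -subr_gt0 cE subr0 mulr_gt0.
Qed.

(** Read as a function of r = sqrt t, p increases along every segment starting at r
    and directed towards the peak, from whichever side; this form treats the
    two branches uniformly. *)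
Lemma logconc_peak_sqr p J (tm : R) :
  J 0 -> (forall s t, 0 <= s <= t -> J t -> J s) ->
  (forall t, J t -> 0 <= t) ->
  (forall t, J t -> 0 < p.[t] /\ 0 < (logconc_form p p).[t]) ->
  J tm -> (forall t, J t -> p.[t] <= p.[tm]) ->
  forall r e, 0 <= r -> J (r ^+ 2) -> r != Num.sqrt tm -> 0 < e <= 1 ->
  p.[r ^+ 2] < p.[(r + e * (Num.sqrt tm - r)) ^+ 2].
Proof.
move=> J0 Jle Jge pP Jtm ptm r e r0 Jr rs /andP[e0 e1].
have [inc dec _ _] := logconc_peak J0 Jle Jge pP Jtm ptm.
have tmE : tm = Num.sqrt tm ^+ 2 by rewrite sqr_sqrtr ?Jge.
set s := Num.sqrt tm in rs tmE *; have s0 : 0 <= s by exact: sqrtr_ge0.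
have [rs'|sr|rsE] := ltgtP r s; last by rewrite rsE eqxx in rs.
- apply: inc; first by rewrite sqr_ge0 ltr_sqr ?nnegrE //; nra.
  by rewrite tmE ler_sqr ?nnegrE //; nra.
- apply: dec => //; apply/andP; split.
    by rewrite [leLHS]tmE ler_sqr ?nnegrE //; nra.
  by rewrite ltr_sqr ?nnegrE //; nra.
Qed.

(** An f that is even about M and increases towards distance s from M has no
    local maximum at any other distance, since points closer to that distance are
    better. A move with e = 1 jumps to the peak, so distance s is also globally
    optimal. *)
Lemma modes_of_peak (D : set R) (f : R -> R) (M s : R) :
  0 <= s -> D (M + s) ->
  (forall m m', D m -> `|m' - M| <= `|m - M| -> D m') ->
  (forall m, f m = f (M + `|m - M|)) ->
  (forall r e, 0 <= r -> D (M + r) -> r != s -> 0 < e <= 1 ->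
     f (M + r) < f (M + (r + e * (s - r)))) ->
  modes_are D f [set M - s; M + s] /\ (0 < s -> local_minima D f M).
Proof.
move=> s0 Ds Dle feven toward.
have DE m : D m -> D (M + `|m - M|).
  by move=> Dm; apply: Dle Dm _; rewrite addrAC subrr add0r normr_id.
have glob x : `|x - M| = s -> global_maxima D f x.
  move=> xs; split; first by apply: Dle Ds _; rewrite xs addrAC subrr add0r ger0_norm.
  move=> x' Dx'; rewrite feven [leRHS]feven xs.
  have [->//|x's] := eqVneq `|x' - M| s.
  have := toward _ 1 (normr_ge0 _) (DE _ Dx') x's.
  by rewrite ltr01 lexx mul1r subrKC => /(_ isT)/ltW.
have glob_loc x : global_maxima D f x -> local_maxima D f x.
  by move=> [Dx fx]; split=> //; apply/nbhs_ballP; exists 1 => //= x' _ /fx.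
have loc x : local_maxima D f x -> `|x - M| = s.
  move=> [Dx /nbhs_ballP[e /= e0 xmax]].
  apply/eqP/negPn/negP => xs; set r := `|x - M| in xs.
  (* A step of length h |s - r| < e from x towards the peak on the same side. *)
  pose k := 1 + `|s - r|.
  have k0 : 0 < k by rewrite ltr_pwDl.
  pose h := Num.min 1 (e / k / 2).
  have h0 : 0 < h by rewrite lt_min ltr01 !divr_gt0.
  have h1 : h <= 1 by rewrite ge_min lexx.
  pose sg : R := if M <= x then 1 else -1.
  have xE : x = M + sg * r.
    by rewrite /sg /r; case: (lerP M x) => _; ring.
  have sg1 : `|sg| = 1 by rewrite /sg; case: ifP; rewrite ?normrN normr1.
  pose x' := M + sg * (r + h * (s - r)).
  have r'0 : 0 <= r + h * (s - r).
    by have r0 : 0 <= r := normr_ge0 _; nra.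
  have x'r : `|x' - M| = r + h * (s - r).
    by rewrite /x' addrAC subrr add0r normrM sg1 mul1r ger0_norm.
  have Dx' : D x'.
    have [rs|sr] := lerP r s.
      by apply: Dle Ds _; rewrite x'r addrAC subrr add0r ger0_norm //; nra.
    by apply: Dle Dx _; rewrite x'r -/r; nra.
  have : f x' <= f x.
    apply: xmax => //; rewrite /ball /= {1}xE /x' -/r.
    have -> : M + sg * r - (M + sg * (r + h * (s - r))) = - (sg * (h * (s - r))).
      by ring.
    rewrite normrN normrM sg1 mul1r normrM (gtr0_norm h0).
    apply: (@le_lt_trans _ _ (h * k)).
      by rewrite ler_pM2l // /k; lra.
    apply: (@le_lt_trans _ _ (e / k / 2 * k)).
      by rewrite ler_pM2r // ge_min lexx orbT.
    by have -> : e / k / 2 * k = e / 2; [field; rewrite gt_eqF | lra].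
  rewrite feven [leRHS]feven x'r -/r leNgt => /negP; apply.
  by apply: toward xs _; [exact: normr_ge0 | exact: DE | rewrite h0].
have setE x : [set M - s; M + s] x <-> `|x - M| = s.
  split=> [[] ->|xs]; try by rewrite addrAC subrr add0r ?normrN ger0_norm.
  have [Mx|xM] := lerP M x; [right|left]; rewrite /= -xs.
    by rewrite ger0_norm ?subr_ge0 //; ring.
  by rewrite ltr0_norm ?subr_lt0 //; ring.
split.
  split; apply/seteqP; split=> x.
  - by move=> /loc /setE.
  - by move=> /setE/glob/glob_loc.
  - by move=> /glob_loc/loc/setE.
  - by move=> /setE/glob.
move=> s_gt0.
have DM : D M by apply: Dle Ds _; rewrite subrr normr0.
split=> //; apply/nbhs_ballP; exists s => //= x; rewrite /ball /= distrC => xs Dx.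
have [->|x0] := eqVneq x M; first by [].
have xM0 : 0 < `|x - M| by rewrite normr_gt0 subr_eq0.
(* From the centre, |x - M| is reached by the step e = |x - M| / s. *)
rewrite -[M in f M]addr0 [leRHS]feven; apply: ltW.
have := toward 0 (`|x - M| / s) (lexx 0).
rewrite addr0 => /(_ DM); rewrite (lt_eqF s_gt0) divr_gt0 //=.
rewrite ler_pdivrMr // mul1r (ltW xs) => /(_ isT isT).
by rewrite add0r subr0 divfK // gt_eqF.
Qed.

(** Near x, f' = p'/p; at x the term - p'^2/p^2 of its derivative vanishes. *)
Lemma ln_poly_critical (p : {poly R}) (x : R) :
  0 < p.[x] -> p^`().[x] = 0 ->
  let f : R -> R := fun m => ln p.[m] in
  [/\ is_derive x 1 f 0, \forall m \near x, derivable f m 1,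
      derivable (derive1 f) x 1 &
      derive1n 2 f x = p^`()^`().[x] / p.[x]].
Proof.
move=> px p'x f.
have df m : 0 < p.[m] -> is_derive m 1 f (p^`().[m] / p.[m]).
  move=> pm; rewrite mulrC.
  exact: (@is_derive1_comp R (@ln R) (horner p) m _ _ (is_derive1_ln pm)).
have npos : \forall m \near x, 0 < p.[m].
  by apply: (@cvgr_gt R R (nbhs x) _ (horner p) _ (@continuous_horner R p x)).
have nf' : {near x, (fun m => p^`().[m] * (p.[m])^-1) =1 derive1 f}.
  near=> m; have pm : 0 < p.[m] by near: m.
  by rewrite derive1E; have [_ ->] := df m pm.
have d2 : is_derive x 1 (fun m => p^`().[m] * (p.[m])^-1) (p^`()^`().[x] / p.[x]).
  have -> : p^`()^`().[x] / p.[x] = p^`().[x] *: (- p.[x] ^- 2 *: p^`().[x]) +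
                   (p.[x])^-1 *: p^`()^`().[x].
    by rewrite p'x scale0r add0r mulrC.
  apply: is_deriveM; apply: is_deriveV; by rewrite gt_eqF.
have [dd dE] := near_eq_is_derive nf' d2.
split.
- by have := df x px; rewrite p'x mul0r.
- near=> m; have pm : 0 < p.[m] by near: m.
  by have [] := df m pm.
- exact: dd.
- by rewrite /derive1n /= derive1E.
Unshelve. all: by end_near. Qed.
End Unimodal.

(** * The likelihood kernel as a polynomial in (m - N/2)^2 *)
Section Kernel.
Variable R : realType.
Implicit Types (N c y : nat) (m t : R).

Lemma falling_neq0 (z : R) k : falling z k != 0 ->
  forall i, (i < k)%N -> z - i%:R != 0.
Proof.
by move=> /prodf_neq0 zk i ik; apply: (zk (Ordinal ik)).
Qed.

Lemma falling_gt0 (z : R) k : k%:R - 1 < z -> 0 < falling z k.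
Proof.
move=> kz; apply: prodr_gt0 => i _.
have : (i.+1%:R : R) <= k%:R by rewrite ler_nat.
by rewrite -natr1; lra.
Qed.

Definition tail_factor N c (k : nat) : R := N%:R / 2 - c%:R - k%:R.

Definition head_poly N c : {poly R} :=
  \prod_(i < c) (((N%:R / 2 - i%:R) ^+ 2)%:P - 'X).

Definition kernel_poly N c y : {poly R} :=
  head_poly N c * (even_odd (tail_factor N c) y).1.

Lemma fallingD N c y x : falling (N%:R / 2 + x) (c + y) =
  falling (N%:R / 2 + x) c * \prod_(k < y) (tail_factor N c k + x).
Proof.
rewrite /falling big_split_ord; congr (_ * _).
by apply: eq_bigr => k _; rewrite /tail_factor /= natrD; ring.
Qed.

(** m^(c) (N-m)^(c) is even in m - N/2, and the two remaining products
    prod (a_k + x) and prod (a_k - x) add up to twice an even part. *)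
Lemma lik_kernelE N c y m : lik_kernel N c y m =
  2 / falling N%:R (2 * c + y) * (kernel_poly N c y).[(m - N%:R / 2) ^+ 2].
Proof.
have [x ->] : exists x, m = N%:R / 2 + x by exists (m - N%:R / 2); ring.
have -> : N%:R / 2 + x - N%:R / 2 = x by ring.
have NmE : N%:R - (N%:R / 2 + x) = N%:R / 2 + - x by field.
rewrite /lik_kernel NmE.
rewrite !fallingD -!even_oddP sqrrN /kernel_poly hornerM.
have -> : (head_poly N c).[x ^+ 2] =
    falling (N%:R / 2 + x) c * falling (N%:R / 2 - x) c.
  rewrite /falling -big_split /= /head_poly horner_prod.
  by apply: eq_bigr => i _; rewrite !hornerE; ring.
by ring.
Qed.

Lemma lik_kernel_sym N c y m : lik_kernel N c y (N%:R - m) = lik_kernel N c y m.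
Proof. by rewrite !lik_kernelE; congr (_ * _.[_]); field. Qed.

Lemma phi_pairsS N c y : phi_pairs R N c y.+1 = phi_pairs R N c y +
  (\sum_(k < y) (tail_factor N c k)^-1) / tail_factor N c y.
Proof.
rewrite /phi_pairs big_ord_recr /= [X in _ + X]big1 => [|k']; last first.
  by rewrite ltnNge -ltnS ltn_ord.
rewrite addr0 mulr_suml -big_split /=; apply: eq_bigr => k _.
by rewrite big_mkcond big_ord_recr /= ltn_ord -big_mkcond -invfM.
Qed.

Lemma even_odd_center (a : nat -> R) y : (forall j, (j < y)%N -> a j != 0) ->
  [/\ (even_odd a y).1.[0] = \prod_(j < y) a j &
      (even_odd a y).2.[0] = \prod_(j < y) a j * \sum_(j < y) (a j)^-1].
Proof.
elim: y => [|y IHy] a0; first by rewrite !big_ord0 /= !hornerE.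
have [] := IHy (fun j jy => a0 j (ltnW jy)); have ay := a0 y (ltnSn y).
rewrite !big_ord_recr /=; case: (even_odd a y) => p q /= pE qE.
rewrite !hornerE pE qE; split; [ring | ].
  by rewrite mulrDr mulfK //; ring.
Qed.

Lemma even_part_center N c y : (forall j, (j < y)%N -> tail_factor N c j != 0) ->
  (even_odd (tail_factor N c) y).1^`().[0] =
  (even_odd (tail_factor N c) y).1.[0] * phi_pairs R N c y.
Proof.
set a := tail_factor N c.
elim: y => [|y IHy] a0; first by rewrite /phi_pairs big_ord0 /= derivC hornerC mulr0.
have [pE qE] := even_odd_center (fun j jy => a0 j (ltnW jy)).
have := IHy (fun j jy => a0 j (ltnW jy)); have ay := a0 y (ltnSn y).
rewrite phi_pairsS -/a /=; case: (even_odd a y) pE qE => p q /= pE qE p'E.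
by rewrite !poly.derivE !hornerE p'E pE qE /=; field.
Qed.

Lemma head_poly_center N c : (forall i, (i < c)%N -> N%:R / 2 - i%:R != 0 :> R) ->
  (head_poly N c)^`().[0] =
  - (head_poly N c).[0] * \sum_(i < c) ((N%:R / 2 - i%:R) ^+ 2)^-1.
Proof.
rewrite /head_poly; elim: c => [|c IHc] a0.
  by rewrite !big_ord0 derivC hornerC mulr0.
have := IHc (fun j jy => a0 j (ltnW jy)); have ac := a0 c (ltnSn c).
rewrite !big_ord_recr /= => IH; rewrite !poly.derivE !hornerE IH /=.
by move: (N%:R / 2 - c%:R) ac => b b0; field.
Qed.

(** phi is the logarithmic derivative at t = 0: E'(0)/E(0) is the sum over pairs,
    and each factor (N/2 - i)^2 - t contributes - 1/(N/2 - i)^2. *)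
Lemma kernel_poly_center N c y :
  (forall i, (i < c + y)%N -> N%:R / 2 - i%:R != 0 :> R) ->
  (kernel_poly N c y)^`().[0] = (kernel_poly N c y).[0] * phi R N c y.
Proof.
move=> a0; rewrite /kernel_poly derivM !hornerE head_poly_center; last first.
  by move=> i ic; apply: a0; rewrite ltn_addr.
rewrite even_part_center; first by rewrite /phi; ring.
move=> j jy; have := a0 (c + j)%N; rewrite ltn_add2l natrD opprD addrA.
by apply.
Qed.

(** The bound on t is the square of the smallest N/2 - i, so every head factor is
    positive. Strictness comes from these factors: there is at least one, as
    c >= 1. *)
Lemma kernel_poly_pos_logconc N c y t : (0 < c)%N -> (c.*2 <= N)%N ->
  central_range N c y -> 0 <= t < (N%:R / 2 - c%:R + 1) ^+ 2 ->
  0 < (kernel_poly N c y).[t] /\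
  0 < (logconc_form (kernel_poly N c y) (kernel_poly N c y)).[t].
Proof.
move=> c0 cN cyN /andP[t0 tb].
have [p0 lp0] : 0 < (even_odd (tail_factor N c) y).1.[t] /\
    0 <= (logconc_form (even_odd (tail_factor N c) y).1
                       (even_odd (tail_factor N c) y).1).[t].
  apply: even_part_logconc => // j jy; rewrite /tail_factor.
  have : (((c + j).*2.+1)%:R : R) <= N%:R.
    by rewrite ler_nat; move: cyN; rewrite /central_range; lia.
  by rewrite -natr1 -mul2n natrM natrD; lra.
have cN' : (c%:R : R) <= N%:R / 2.
  by have : (c.*2%:R : R) <= N%:R by [rewrite ler_nat]; rewrite -mul2n natrM; lra.
have fac i : (i < c)%N -> 0 < (N%:R / 2 - i%:R) ^+ 2 - t.
  move=> ic; rewrite subr_gt0 (lt_le_trans tb) //.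
  have : (i.+1%:R : R) <= c%:R by rewrite ler_nat.
  by rewrite -natr1 => ?; rewrite ler_sqr ?nnegrE; lra.
have h0 k : (k <= c)%N -> 0 < (head_poly N k).[t].
  move=> kc; rewrite horner_prod; apply: prodr_gt0 => i _.
  by rewrite !hornerE; apply/fac/(leq_trans (ltn_ord i)).
have lhS k : (k < c)%N -> 0 <= (logconc_form (head_poly N k) (head_poly N k)).[t] ->
    0 < (logconc_form (head_poly N k.+1) (head_poly N k.+1)).[t].
  move=> kc lk; rewrite /head_poly big_ord_recr /= logconc_formM.
  apply: ltr_wpDr; first by rewrite mulr_ge0 ?sqr_ge0.
  apply: mulr_gt0; first by rewrite exprn_gt0 ?h0 1?ltnW.
  by rewrite /logconc_form !poly.derivE !hornerE; lra.
have lh k : (k <= c)%N -> 0 <= (logconc_form (head_poly N k) (head_poly N k)).[t].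
  elim: k => [_|k IHk kc]; last by apply/ltW/lhS/IHk => //; exact: ltnW.
  by rewrite /head_poly big_ord0 /logconc_form !poly.derivE !hornerE; lra.
have lhc : 0 < (logconc_form (head_poly N c) (head_poly N c)).[t].
  by case: c c0 {cN cyN p0 lp0 cN' fac h0 tb} lhS lh => // k _ lhS lh; apply/lhS/lh.
split; first by rewrite hornerM mulr_gt0 ?h0.
rewrite /kernel_poly logconc_formM.
apply: ltr_wpDl; first by rewrite mulr_ge0 ?sqr_ge0.
by rewrite mulr_gt0 ?exprn_gt0.
Qed.
End Kernel.

(** * Sign and monotonicity of phi, and the modes of Lambda *)
Section Modes.
Variable R : realType.
Implicit Types (N c y : nat) (m t : R).

Lemma even_poly_center (k M : R) (g : {poly R}) :
  let p := k%:P * (g \Po ('X - M%:P) ^+ 2) in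
  [/\ p.[M] = k * g.[0], p^`().[M] = 0 & p^`()^`().[M] = 2 * k * g^`().[0]].
Proof.
move=> p; have sq0 : (('X - M%:P) ^+ 2).[M] = 0 by rewrite horner_exp !hornerE subrr expr0n.
have dsq : (('X - M%:P) ^+ 2)^`() = ('X - M%:P) *+ 2.
  by rewrite !poly.derivE; ring.
rewrite /p !(derivM, derivD, deriv_comp, derivC, dsq, derivMn, derivX, derivN).
by split; rewrite !hornerE ?horner_comp ?sq0 ?hornerE ?sq0 /= ?subrr; ring.
Qed.

(** The likelihood being positive at N/2, no factor N/2 - i, i < c + y, vanishes
    there, so phi has no vanishing denominator. *)
Lemma Lambda_center N c y : 0 < lik_kernel N c y (N%:R / 2 : R) ->
  let L : R -> R := Lambda N c y in
  [/\ is_derive (N%:R / 2 : R) 1 L 0,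
      \forall m \near (N%:R / 2 : R), derivable L m 1,
      derivable (derive1 L) (N%:R / 2) 1 &
      derive1n 2 L (N%:R / 2) = 2 * phi R N c y].
Proof.
set M : R := N%:R / 2 => lM L.
have F0 i : (i < c + y)%N -> M - i%:R != 0.
  apply: falling_neq0; apply/eqP => f0; move: lM.
  by rewrite /lik_kernel -/M (_ : N%:R - M = M) ?f0 ?mulr0 ?mul0r ?addr0 ?mul0r ?ltxx // /M; field.
set kappa : R := 2 / falling N%:R (2 * c + y).
set G := kernel_poly R N c y.
pose p : {poly R} := kappa%:P * (G \Po ('X - M%:P) ^+ 2).
have pE m : p.[m] = lik_kernel N c y m.
  by rewrite lik_kernelE hornerM horner_comp !hornerE.
have [pME p'M p''M] := even_poly_center kappa M G.
have pM : 0 < p.[M] by rewrite pE.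
have [] := ln_poly_critical pM p'M.
have -> : (fun m => ln p.[m]) = L by apply/funext => m; rewrite pE.
move=> dL ndL dL' d2L; split=> //; rewrite d2L p''M kernel_poly_center //.
rewrite -/p pME in pM *.
have : kappa * G.[0] != 0 by rewrite gt_eqF.
by rewrite mulf_eq0 negb_or => /andP[k0 G0]; field; apply/andP.
Qed.

Lemma lik_kernel_pos N c y m : (c.*2 <= N)%N -> central_range N c y ->
  (0 < lik_kernel N c y m) = (0 < (kernel_poly R N c y).[(m - N%:R / 2) ^+ 2]).
Proof.
move=> cN cyN; rewrite lik_kernelE pmulr_rgt0 // divr_gt0 // falling_gt0 //.
have : ((2 * c + y)%:R : R) <= N%:R.
  by rewrite ler_nat; move: cyN; rewrite /central_range; lia.
by lra.
Qed.

Lemma phi_pairs0 N c : phi_pairs R N c 0 = 0.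
Proof. by rewrite /phi_pairs big_ord0. Qed.

Lemma phi_pairs1 N c : phi_pairs R N c 1 = 0.
Proof. by rewrite phi_pairsS phi_pairs0 big_ord0 mul0r addr0. Qed.

Lemma phi_lt0 N c y : (0 < c)%N -> (c.*2 <= N)%N -> (y <= 1)%N ->
  phi R N c y < 0.
Proof.
move=> c0 cN y1.
have -> : phi R N c y = - \sum_(i < c) ((N%:R / 2 - i%:R) ^+ 2)^-1.
  by rewrite /phi; case: y y1 => [|[|//]] _;
    rewrite ?phi_pairs0 ?phi_pairs1 sub0r.
have pos (i : 'I_c) : 0 < ((N%:R / 2 - i%:R) ^+ 2)^-1 :> R.
  rewrite invr_gt0 exprn_gt0 //.
  have : ((i.*2.+1)%:R : R) <= N%:R by rewrite ler_nat; have := ltn_ord i; lia.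
  by rewrite -natr1 -mul2n natrM; lra.
rewrite oppr_lt0 (bigD1 (Ordinal c0)) //=; apply: ltr_pwDl.
  exact: (pos (Ordinal c0)).
by apply: sumr_ge0 => i _; exact/ltW.
Qed.

(** Passing from y to y+1 adds the pairs (k, y), k < y, all positive in the central
    range; there are none when y = 0. *)
Lemma phiS N c y : central_range N c y.+1 ->
  phi R N c y <= phi R N c y.+1 /\ ((0 < y)%N -> phi R N c y < phi R N c y.+1).
Proof.
move=> cyN; rewrite /phi phi_pairsS.
have pos k : (k <= y)%N -> 0 < tail_factor R N c k.
  move=> ky; have : (((c + k).*2.+1)%:R : R) <= N%:R.
    by rewrite ler_nat; move: cyN; rewrite /central_range; lia.
  by rewrite -natr1 -mul2n natrM natrD /tail_factor; lra.
have posV (k : 'I_y) : 0 < (tail_factor R N c k)^-1.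
  by rewrite invr_gt0 pos // ltnW.
split=> [|y0]; last first.
  rewrite ltrD2r ltrDl; apply: divr_gt0 (pos _ (leqnn y)).
  rewrite (bigD1 (Ordinal y0)) //=; apply: ltr_pwDl.
    exact: (posV (Ordinal y0)).
  by apply: sumr_ge0 => k _; exact/ltW.
rewrite lerD2r lerDl; apply: divr_ge0; last exact/ltW/pos.
by apply: sumr_ge0 => k _; exact/ltW.
Qed.

Lemma phi_homo N c y1 y2 : (y1 <= y2)%N -> central_range N c y2 ->
  phi R N c y1 <= phi R N c y2.
Proof.
elim: y2 => [|y IHy]; first by rewrite leqn0 => /eqP ->.
rewrite leq_eqVlt => /predU1P[-> //|y1y] cyN.
apply: le_trans (phiS cyN).1; apply: IHy => //.
by move: cyN; rewrite /central_range; lia.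
Qed.

Lemma phi_strict_homo N c y1 y2 : (1 <= y1)%N -> (y1 < y2)%N ->
  central_range N c y2 -> phi R N c y1 < phi R N c y2.
Proof.
move=> y10; case: y2 => // y; rewrite ltnS => y1y cyN.
apply: le_lt_trans ((phiS cyN).2 (leq_trans y10 y1y)).
by apply: phi_homo => //; move: cyN; rewrite /central_range; lia.
Qed.

(** Both ranges of m are intervals of values of t = (m - N/2)^2 starting at 0, on
    which the kernel polynomial attains its maximum. The closed range is compact;
    on the half-open one the polynomial vanishes at the missing endpoint, so the
    maximum over the closure is inside. The range is not reduced to t = 0 when
    y > 0, because then c < N/2. *)
Lemma range_kernel N c y (D : set R) : (0 < c)%N -> (c.*2 <= N)%N ->
  central_range N c y -> D = param_range N c \/ D = kernel_range N c ->
  exists J : set R,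
  [/\ forall m, D m <-> J ((m - N%:R / 2) ^+ 2),
      J 0, forall s t, 0 <= s <= t -> J t -> J s,
      forall t, J t -> 0 <= t < (N%:R / 2 - c%:R + 1) ^+ 2 &
      (exists2 tm, J tm & forall t, J t ->
         (kernel_poly R N c y).[t] <= (kernel_poly R N c y).[tm]) /\
      ((0 < y)%N -> exists2 t, 0 < t & J t)].
Proof.
move=> c0 cN cyN.
have cN' : (c%:R : R) <= N%:R / 2.
  by have : (c.*2%:R : R) <= N%:R by [rewrite ler_nat]; rewrite -mul2n natrM; lra.
set M : R := N%:R / 2 in cN' *; set G := kernel_poly R N c y.
have My : (0 < y)%N -> 0 < M - c%:R.
  move=> y0; have : ((c.*2.+1)%:R : R) <= N%:R.
    by rewrite ler_nat; move: cyN; rewrite /central_range; lia.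
  by rewrite -natr1 -mul2n natrM /M; lra.
have max (A : R) : 0 <= A -> exists2 tm, 0 <= tm <= A &
    forall t, 0 <= t <= A -> G.[t] <= G.[tm].
  move=> A0; have [|tm] := @EVT_max R (horner G) 0 A A0.
    by apply: continuous_subspaceT => x; apply: continuous_horner.
  by rewrite in_itv /= => tmA tmax; exists tm => // t tA; apply: tmax; rewrite in_itv.
have absE m (a : R) : 0 <= a -> ((m - M) ^+ 2 <= a ^+ 2) = (- a <= m - M <= a).
  by move=> a0; rewrite -real_normK ?num_real // ler_sqr ?nnegrE // ler_norml.
have absE' m (a : R) : 0 <= a -> ((m - M) ^+ 2 < a ^+ 2) = (- a < m - M < a).
  by move=> a0; rewrite -real_normK ?num_real // ltr_sqr ?nnegrE // ltr_norml.
have NM : N%:R = M + M by rewrite /M; field.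
case=> ->.
- exists [set t | 0 <= t <= (M - c%:R) ^+ 2]; split.
  + move=> m; rewrite /param_range /= sqr_ge0 /= absE ?subr_ge0 //.
    by rewrite NM; split=> /andP[? ?]; apply/andP; split; lra.
  + by rewrite /= lexx sqr_ge0.
  + by move=> s t /= /andP[s0 st] /andP[_ tA]; rewrite s0 (le_trans st).
  + by move=> t /= /andP[-> tA]; rewrite (le_lt_trans tA) // ltr_sqr ?nnegrE; lra.
  + split; first by have [tm ? ?] := max _ (sqr_ge0 (M - c%:R)); exists tm.
    move=> /My Mc; exists ((M - c%:R) ^+ 2); first by rewrite exprn_gt0.
    by rewrite /= lexx sqr_ge0.
- have b0 : 0 < M - c%:R + 1 by lra.
  have b20 : 0 < (M - c%:R + 1) ^+ 2 by rewrite exprn_gt0.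
  exists [set t | 0 <= t < (M - c%:R + 1) ^+ 2]; split.
  + move=> m; rewrite /kernel_range /= sqr_ge0 /= absE' ?ltW //.
    by rewrite NM; split=> /andP[? ?]; apply/andP; split; lra.
  + by rewrite /= lexx.
  + by move=> s t /= /andP[s0 st] /andP[_ tA]; rewrite s0 (le_lt_trans st).
  + by [].
  + split; last first.
      move=> _; exists ((M - c%:R + 1) ^+ 2 / 2); first by rewrite divr_gt0.
      by rewrite /=; apply/andP; split; lra.
    have [tm /andP[tm0 tmb] tmax] := max _ (ltW b20).
    have Gb : G.[(M - c%:R + 1) ^+ 2] = 0.
      rewrite /G /kernel_poly /head_poly; case: c c0 {cN cyN cN' My G max b0 b20 tmb tmax} => // c _.
      by rewrite big_ord_recr /= !hornerM -/M -natr1 !hornerE; ring.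
    have G0 : 0 < G.[0].
      by have [] := @kernel_poly_pos_logconc R N c y 0 c0 cN cyN; rewrite ?lexx.
    exists tm => /=; last by move=> t /andP[t0 tb]; rewrite tmax // t0 ltW.
    rewrite tm0 lt_neqAle tmb andbT; apply/eqP => tmE.
    have := tmax 0; rewrite lexx ltW // => /(_ isT).
    by rewrite tmE Gb leNgt G0.
Qed.

(** Here s = sqrt tm, with tm the peak of the kernel polynomial; the case s = 0 is
    that of a single central mode. *)
Lemma range_modes N c y (D : set R) : (0 < c)%N -> (c.*2 <= N)%N ->
  central_range N c y -> D = param_range N c \/ D = kernel_range N c ->
  (forall m, D m -> 0 < lik_kernel N c y m) /\
  exists s : R,
    [/\ 0 <= s,
        modes_are D (Lambda N c y) [set (N%:R / 2 - s); (N%:R / 2 + s)],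
        0 < s -> local_minima D (Lambda N c y) (N%:R / 2),
        phi R N c y <= 0 -> s = 0 &
        0 < phi R N c y -> 0 < s].
Proof.
move=> c0 cN cyN DE.
have [J [DJ J0 Jle JB [[tm Jtm tmax] Jpos]]] := range_kernel c0 cN cyN DE.
have lcG t : J t -> 0 < (kernel_poly R N c y).[t] /\
    0 < (logconc_form (kernel_poly R N c y) (kernel_poly R N c y)).[t].
  by move=> /JB; apply: kernel_poly_pos_logconc.
have Jge t : J t -> 0 <= t by move=> /JB /andP[].
have lpos m : D m -> 0 < lik_kernel N c y m.
  by rewrite lik_kernel_pos // => /DJ/lcG[].
split=> //.
set M : R := N%:R / 2 in DJ lpos *.
have [_ _ s0 s1] := logconc_peak J0 Jle Jge lcG Jtm tmax.
have Gphi : (kernel_poly R N c y)^`().[0] = (kernel_poly R N c y).[0] * phi R N c y.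
  apply: kernel_poly_center => i ic.
  have : ((i.*2.+1)%:R : R) <= N%:R.
    by rewrite ler_nat; move: cyN; rewrite /central_range; lia.
  by rewrite -natr1 -mul2n natrM => ?; rewrite gt_eqF //; lra.
have [G0 _] := lcG _ J0.
have shift r : M + r - M = r by ring.
exists (Num.sqrt tm).
have [modes minM] : modes_are D (Lambda N c y) [set M - Num.sqrt tm; M + Num.sqrt tm] /\
    (0 < Num.sqrt tm -> local_minima D (Lambda N c y) M).
  apply: modes_of_peak; first exact: sqrtr_ge0.
  - by apply/DJ; rewrite shift sqr_sqrtr ?Jge.
  - move=> m m' /DJ Jm mm'; apply/DJ; apply: Jle Jm.
    rewrite sqr_ge0 -[X in X <= _]real_normK ?num_real //.
    by rewrite -[leRHS]real_normK ?num_real // ler_sqr ?nnegrE.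
  - move=> m; rewrite /Lambda !lik_kernelE -/M shift.
    by rewrite real_normK ?num_real.
  - move=> r e r0 /[dup] Dr /DJ; rewrite shift => Jr rs e01.
    have lt := logconc_peak_sqr J0 Jle Jge lcG Jtm tmax r0 Jr rs e01.
    set r' := r + _ in lt *.
    have l0 := lpos _ Dr.
    have l1 : lik_kernel N c y (M + r) < lik_kernel N c y (M + r').
      move: l0; rewrite !lik_kernelE -/M !shift => l0.
      rewrite ltr_pM2l // -(@pmulr_lgt0 _ (kernel_poly R N c y).[r ^+ 2]) //.
      by have [] := lcG _ Jr.
    by rewrite /Lambda ltr_ln ?posrE // (lt_trans l0).
split=> //.
- by move=> phi0; rewrite s0 ?sqrtr0 // Gphi pmulr_rle0.
- move=> phi0; rewrite sqrtr_gt0 s1 ?Gphi ?mulr_gt0 //; apply: Jpos.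
  rewrite lt0n; apply: contraTneq phi0 => ->.
  by rewrite -leNgt ltW ?phi_lt0.
Qed.

Lemma one_central_modeE N (D : set R) (f : R -> R) (s : R) :
  modes_are D f [set (N%:R / 2 - s); (N%:R / 2 + s)] -> s = 0 ->
  one_central_mode D N f.
Proof. by move=> + s0; rewrite s0 subr0 addr0 setUid. Qed.

Lemma MLE_Lambda N c y (D : set R) : (0 < c)%N ->
  (forall m, D m -> 0 < lik_kernel N c y m) ->
  MLE D N c y = global_maxima D (Lambda N c y).
Proof.
move=> c0 lpos.
have binpos : 0 < 'C((2 * c + y).-1, c.-1)%:R :> R.
  by rewrite ltr0n bin_gt0; lia.
have pmfE m : mnh_pmf N m c y = 'C((2 * c + y).-1, c.-1)%:R * lik_kernel N c y m.
  by rewrite /mnh_pmf /lik_kernel [X in X / _]addrC.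
apply/seteqP; split=> x [Dx xmax]; split=> // x' Dx'; have := xmax _ Dx'.
  by rewrite !pmfE ler_pM2l // /Lambda ler_ln ?posrE ?lpos.
by rewrite !pmfE ler_pM2l // /Lambda ler_ln ?posrE ?lpos.
Qed.
End Modes.

Theorem mainTheorem6 (R : realType) (d : measure_display)
    (T : measurableType d) (P : probability T R) (Y : {RV P >-> nat})
    (N m0 c y : nat)
    (hY : max_neg_hypergeometric Y N m0 c)
    (hy : (0 < P (Y @^-1` [set y]))%E) :
  let L : R -> R := Lambda N c y in
  let L2 : R := derive1n 2 L (N%:R / 2) in
  (0 < lik_kernel N c y (N%:R / 2 : R) -> is_derive (N%:R / 2 : R) 1 L 0) /\
  (central_range N c y ->
   forall D : set R, D = param_range N c \/ D = kernel_range N c ->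
   [/\ forall m, D m -> 0 < lik_kernel N c y m,
       one_central_mode D N L \/ two_symmetric_modes D N L,
       global_maxima D L (N%:R / 2) \/ local_minima D L (N%:R / 2),
       L2 < 0 -> one_central_mode D N L &
       0 < L2 -> local_minima D L (N%:R / 2) /\ two_symmetric_modes D N L]) /\
  (0 < lik_kernel N c y (N%:R / 2 : R) ->
   [/\ \forall m \near (N%:R / 2 : R), derivable L m 1,
       derivable (derive1 L) (N%:R / 2) 1 &
       Num.sg L2 = Num.sg (phi R N c y)]) /\
  [/\ phi_pairs R N c 0 = 0 /\ phi_pairs R N c 1 = 0,
      phi R N c 0 < 0 /\ phi R N c 1 < 0,
      (central_range N c y ->
       forall D : set R, D = param_range N c \/ D = kernel_range N c ->
       (phi R N c y < 0 -> MLE D N c y = [set N%:R / 2]) /\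
       (0 < phi R N c y -> two_symmetric_modes D N L)),
      (forall y1 y2 : nat, (y1 <= y2)%N -> central_range N c y2 ->
       phi R N c y1 <= phi R N c y2) /\
      (forall y1 y2 : nat, (1 <= y1)%N -> (y1 < y2)%N -> central_range N c y2 ->
       phi R N c y1 < phi R N c y2) &
      forall m : R, 0 < m < N%:R -> L m = L (N%:R - m)] /\
  (exists N' c' y' : nat,
    [/\ (1 <= c')%N, (c'.*2 <= N')%N, central_range N' c' y',
        0 < phi R N' c' y' &
        forall D : set R,
          D = param_range N' c' \/ D = kernel_range N' c' ->
          two_symmetric_modes D N' (Lambda N' c' y' : R -> R)]).
Proof.
have [c0 cm mN cNm _] := hY.
have cN : (c.*2 <= N)%N by lia.
move=> L L2.
have sgL2 : 0 < lik_kernel N c y (N%:R / 2 : R) -> Num.sg L2 = Num.sg (phi R N c y).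
  by move=> /Lambda_center[_ _ _ d2]; rewrite /L2 d2 sgrM gtr0_sg ?mul1r.
split; first by move=> /Lambda_center[].
split.
  move=> cyN D DE.
  have [lpos [s [s0 modes minM phi_le0 phi_gt0]]] := range_modes c0 cN cyN DE.
  have lM : 0 < lik_kernel N c y (N%:R / 2 : R).
    have [lposP _] := range_modes c0 cN cyN (or_introl (erefl (@param_range R N c))).
    apply: lposP; rewrite /param_range /=.
    have : (c.*2%:R : R) <= N%:R by rewrite ler_nat.
    by rewrite -mul2n natrM => ?; apply/andP; split; lra.
  have two : 0 < s -> two_symmetric_modes D N L by exists s.
  split=> //.
  - have [s_eq0|s_neq0] := eqVneq s 0; first by left; apply: one_central_modeE s_eq0.
    by right; apply: two; rewrite lt_def s_neq0.
  - have [s_eq0|s_neq0] := eqVneq s 0; last first.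
      by right; apply: minM; rewrite lt_def s_neq0.
    by left; have [_ ->] := one_central_modeE modes s_eq0.
  - move=> L2_lt0; apply: (one_central_modeE modes); apply/phi_le0/ltW.
    by rewrite -sgr_lt0 -sgL2 // sgr_lt0.
  - move=> L2_gt0; have s_gt0 : 0 < s by apply: phi_gt0; rewrite -sgr_gt0 -sgL2 // sgr_gt0.
    by split; [apply: minM | apply: two].
split.
  by move=> lM; have [_ ? ? _] := Lambda_center lM; split=> //; exact: sgL2.
split; last first.
  (* With N = 5, c = 1, y = 2: phi = 1 / (3/2 * 1/2) - 1 / (5/2)^2 = 88/75. *)
  have ex_range : central_range 5 1 2 by [].
  have ex_phi : 0 < phi R 5 1 2.
    rewrite /phi phi_pairsS phi_pairs1 !big_ord_recr !big_ord0 /tail_factor /=.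
    by rewrite !add0r [ltRHS](_ : _ = 88 / 75) ?divr_gt0 //; field.
  exists 5%N, 1%N, 2%N; split=> // D DE.
  have [_ [s [_ modes _ _ s_gt0]]] := @range_modes R 5 1 2 D isT isT ex_range DE.
  by exists s => //; apply: s_gt0.
split.
- by rewrite phi_pairs0 phi_pairs1.
- by rewrite !phi_lt0.
- move=> cyN D DE.
  have [lpos [s [s0 modes _ phi_le0 phi_gt0]]] := range_modes c0 cN cyN DE.
  split=> [phi_lt0|phi_pos]; last by exists s => //; exact: phi_gt0.
  rewrite MLE_Lambda //.
  by have [_ ->] := one_central_modeE modes (phi_le0 (ltW phi_lt0)).
- by split=> y1 y2; [exact: phi_homo | exact: phi_strict_homo].
- by move=> m _; rewrite /L /Lambda lik_kernel_sym.
Qed.
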